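(* Let $\mathbf{x}_1,\dots,\mathbf{x}_N\in\mathbb{R}^K$ be nonzero, let $\mathbf{T}$ be a real symmetric positive definite $K\times K$ matrix, and let $\alpha_0\ge0$. Consider the following two equations for a real symmetric positive definite $K\times K$ matrix $\boldsymbol{\Sigma}$: $$\text{(KL)}\quad \boldsymbol{\Sigma}=\frac{1}{1+\alpha_0}\frac KN\sum_{i=1}^N\frac{\mathbf{x}_i\mathbf{x}_i^T}{\mathbf{x}_i^T\boldsymbol{\Sigma}^{-1}\mathbf{x}_i}+\frac{\alpha_0}{1+\alpha_0}\mathbf{T},$$ $$\text{(W)}\quad \boldsymbol{\Sigma}=\frac{1}{1+\alpha_0}\frac KN\sum_{i=1}^N\frac{\mathbf{x}_i\mathbf{x}_i^T}{\mathbf{x}_i^T\boldsymbol{\Sigma}^{-1}\mathbf{x}_i}+\frac{\alpha_0}{1+\alpha_0}\frac{K\mathbf{T}}{\mathrm{Tr}(\boldsymbol{\Sigma}^{-1}\mathbf{T})}.$$ Every solution of (KL) is a solution of (W); conversely, for every solution $\boldsymbol{\Sigma}$ of (W) there is a scalar $c>0$ such that $c\boldsymbol{\Sigma}$ is a solution of (KL). *)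

(* Defs.v *)
(* The real numbers are an arbitrary R : realType; vectors of R^K are columns. *)
From HB Require Import structures.
From mathcomp Require Import all_boot all_order all_algebra.
From mathcomp Require Import reals.
Set Implicit Arguments.
Unset Strict Implicit.
Unset Printing Implicit Defensive.
Import Order.TTheory GRing.Theory Num.Theory.
Local Open Scope ring_scope.

(* v^T A v; the product is a 1 x 1 matrix, hence the [0 0]. *)
Definition qform (R : realType) (K : nat) (A : 'M[R]_K) (v : 'cV[R]_K) : R :=
  (v^T *m A *m v) 0 0.

Definition sym_posdef (R : realType) (K : nat) (A : 'M[R]_K) : Prop :=
  A^T = A /\ forall v : 'cV[R]_K, v != 0 -> 0 < qform A v.

(* [invmx S] is the true inverse of S only for S in unitmx, and division by 0
   yields 0; the terms below are only used at positive definite S, with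
   nonzero x i. *)
Definition data_term (R : realType) (K N : nat) (x : 'I_N -> 'cV[R]_K)
    (a0 : R) (S : 'M[R]_K) : 'M[R]_K :=
  (1 / (1 + a0) * (K%:R / N%:R)) *:
    \sum_(i < N) (qform (invmx S) (x i))^-1 *: (x i *m (x i)^T).

Definition KL_solution (R : realType) (K N : nat) (x : 'I_N -> 'cV[R]_K)
    (T : 'M[R]_K) (a0 : R) (S : 'M[R]_K) : Prop :=
  sym_posdef S /\
  S = data_term x a0 S + (a0 / (1 + a0)) *: T.

Definition W_solution (R : realType) (K N : nat) (x : 'I_N -> 'cV[R]_K)
    (T : 'M[R]_K) (a0 : R) (S : 'M[R]_K) : Prop :=
  sym_posdef S /\
  S = data_term x a0 S
      + (a0 / (1 + a0)) *: ((\tr (invmx S *m T))^-1 *: (K%:R *: T)).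

(* Main.v *)
(* Multiplying either equation by S^-1 and taking traces turns the data term
   into K / (1 + a0), so a solution S of (KL) with a0 > 0 has tr(S^-1 T) = K.
   The data term is homogeneous of degree 1 in S, so for S solving (W) the scalar
   c = tr(S^-1 T) / K works; it is positive because the trace of a product of two
   positive definite matrices is. *)
Require Import Defs.
From mathcomp Require Import all_boot all_order all_algebra.
From mathcomp Require Import reals ring.
Set Implicit Arguments.
Unset Strict Implicit.
Unset Printing Implicit Defensive.
Import Order.TTheory GRing.Theory Num.Theory.
Local Open Scope ring_scope.

Section PositiveDefinite.
Variable R : realType.

Lemma mxtrace_mul_outer n (A : 'M[R]_n) (v : 'cV[R]_n) :
  \tr (A *m (v *m v^T)) = qform A v.
Proof. by rewrite mulmxA mxtrace_mulC mulmxA trace_mx11. Qed.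

Lemma qformZ n (A : 'M[R]_n) a (v : 'cV[R]_n) :
  qform (a *: A) v = a * qform A v.
Proof. by rewrite /qform -scalemxAr -scalemxAl mxE. Qed.

Lemma sym_posdefZ n (A : 'M[R]_n) a :
  0 < a -> sym_posdef A -> sym_posdef (a *: A).
Proof.
move=> a_gt0 [symA posA]; split=> [|v v0]; first by rewrite linearZ /= symA.
by rewrite qformZ mulr_gt0 ?posA.
Qed.

Lemma sym_posdef_unitmx n (A : 'M[R]_n) : sym_posdef A -> A \in unitmx.
Proof.
move=> [_ posA]; rewrite unitmxE unitfE; apply/det0P => -[v v0 vA0].
have := posA v^T; rewrite /qform trmxK vA0 mul0mx mxE ltxx => posv.
suff: false by []; apply: posv; by rewrite trmx_eq0.
Qed.

(** The substitution [v = A w] turns [v^T A^-1 v] into [w^T A w]. *)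
Lemma sym_posdef_invmx n (A : 'M[R]_n) : sym_posdef A -> sym_posdef (invmx A).
Proof.
move=> pdA; have uA := sym_posdef_unitmx pdA; case: pdA => symA posA.
have symI : (invmx A)^T = invmx A by rewrite trmx_inv symA.
split=> // v v0; have -> : qform (invmx A) v = qform A (invmx A *m v).
  by rewrite /qform trmx_mul symI -!mulmxA [A *m _]mulmxA mulmxV // mul1mx.
apply: posA; apply: contraNneq v0 => Av0.
by rewrite -(mulKVmx uA v) Av0 mulmx0.
Qed.

(* Induction on n: peeling off the first row and column of B leaves a rank one
   term and the Schur complement, which is again positive definite. *)
Lemma mxtrace_mul_posdef_gt0 n (A B : 'M[R]_n) : (0 < n)%N ->
  (forall v : 'cV[R]_n, v != 0 -> 0 < qform A v) -> sym_posdef B ->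
  0 < \tr (A *m B).
Proof.
elim: n A B => // n IHn A B _ posA.
rewrite -[B](@submxK _ 1 n 1 n); set a := ulsubmx _; set b' := ursubmx _.
set b := dlsubmx _; set D := drsubmx _ => -[].
rewrite (@tr_block_mx _ 1 n 1 n) => /(@eq_block_mx _ 1 n 1 n)[_ b'E _ symD] posB.
have {}b'E : b' = b^T by rewrite -b'E.
rewrite b'E in posB *; clear b'E.
have aE : a = (a 0 0)%:M by rewrite -mx11_scalar.
set r := a 0 0 in aE.
have r_gt0 : 0 < r.
  have /posB : (col_mx 1 0 : 'cV[R]_(1 + n)) != 0.
    by rewrite col_mx_eq0 oner_eq0.
  rewrite /qform (@tr_col_mx _ 1 n) (@mul_row_block _ 1 1 n 1 n).
  by rewrite (@mul_row_col _ 1 1 n) !trmx0 !mul0mx !addr0 mulmx0 addr0 trmx1 mul1mx mulmx1.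
have rn0 : r != 0 by rewrite gt_eqF.
(* [w] is the first column of the matrix, so [r^-1 w w^T] reproduces its first row and column,
   leaving the Schur complement [C] of the pivot [r]. *)
pose w : 'cV[R]_(1 + n) := col_mx a b.
pose C := D - r^-1 *: (b *m b^T).
have BE : block_mx a b^T b D = r^-1 *: (w *m w^T) + block_mx 0 0 0 C.
  rewrite /w tr_col_mx mul_col_row scale_block_mx add_block_mx.
  rewrite !addr0 aE tr_scalar_mx !mul_scalar_mx mul_mx_scalar.
  by rewrite !scalerA mulVf // !scale1r /C addrC subrK.
have pdC : sym_posdef C.
  split=> [|v v0].
    by rewrite /C linearB linearZ /= trmx_mul trmxK symD.
  (* The first entry of [u] is chosen to make [u] orthogonal to [w]: the rank one term then vanishes
     at [u], and the whole form at [u] equals the form of [C] at [v]. *)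
  pose u : 'cV[R]_(1 + n) := col_mx (- r^-1 *: (b^T *m v)) v.
  have /posB : u != 0 by rewrite col_mx_eq0 (negPf v0) andbF.
  have wu : w^T *m u = 0.
    rewrite /w tr_col_mx mul_row_col aE tr_scalar_mx mul_scalar_mx scalerA.
    by rewrite mulrN mulfV // scaleN1r addNr.
  rewrite /qform BE mulmxDr mulmxDl -scalemxAr -scalemxAl -!mulmxA wu !mulmx0.
  rewrite scaler0 add0r /u (@mul_block_col _ 1 n 1 n) !mul0mx !add0r
    (@tr_col_mx _ 1 n) (@mul_row_col _ 1 1 n).
  by rewrite mulmx0 add0r.
have w0 : w != 0.
  rewrite col_mx_eq0 negb_and; apply/orP; left.
  by apply: contraNneq rn0 => a00; rewrite /r a00 mxE.
rewrite BE mulmxDr mxtraceD -scalemxAr mxtraceZ mxtrace_mul_outer.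
(* The rank one term alone gives strictness, through [qform A w]. The Schur term need only be
   nonnegative, which allows [n = 0], where the induction hypothesis does not apply. *)
rewrite ltr_wpDr //; last by rewrite mulr_gt0 ?invr_gt0 ?posA.
rewrite -[A](@submxK _ 1 n 1 n) (@mulmx_block _ 1 n 1 n 1 n) !mulmx0 !add0r.
rewrite (@mxtrace_block _ 1 n) mxtrace0 add0r.
have [n0|n_gt0] := posnP n; first by subst n; rewrite /mxtrace big_ord0.
apply/ltW/IHn => // v v0; have /posA : (col_mx 0 v : 'cV[R]_(1 + n)) != 0.
  by rewrite col_mx_eq0 (negPf v0) andbF.
rewrite -[A](@submxK _ 1 n 1 n) /qform (@tr_col_mx _ 1 n).
rewrite (@mul_row_block _ 1 1 n 1 n) (@mul_row_col _ 1 1 n) block_mxKdr.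
by rewrite trmx0 !mul0mx !add0r mulmx0 add0r.
Qed.

Variables (K N : nat) (x : 'I_N -> 'cV[R]_K) (a0 : R).

Lemma data_termZ (S : 'M[R]_K) c : c != 0 -> S \in unitmx ->
  data_term x a0 (c *: S) = c *: data_term x a0 S.
Proof.
move=> c0 uS; rewrite /data_term scalerA [c * _]mulrC -[RHS]scalerA; congr (_ *: _).
rewrite scaler_sumr; apply: eq_bigr => i _.
by rewrite invmxZ ?unitmxZ ?unitfE // qformZ invfM invrK scalerA.
Qed.

(** Each summand has trace 1 after multiplication by [S^-1], since the trace of [S^-1 x_i x_i^T] is
    exactly its denominator; the [N] ones cancel the factor [1 / N]. *)
Lemma mxtrace_invmx_data_term (S : 'M[R]_K) :
  (0 < N)%N -> (forall i, x i != 0) -> sym_posdef S ->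
  \tr (invmx S *m data_term x a0 S) = K%:R / (1 + a0).
Proof.
move=> N0 x0 /sym_posdef_invmx[_ posI].
rewrite /data_term -scalemxAr mxtraceZ mulmx_sumr raddf_sum /=.
under eq_bigr => i _ do
  rewrite -scalemxAr mxtraceZ mxtrace_mul_outer mulVf ?gt_eqF ?posI //.
rewrite sumr_const card_ord.
have N_neq0 : N%:R != 0 :> R by rewrite pnatr_eq0 -lt0n.
by rewrite div1r -mulrA divfK // mulrC.
Qed.

End PositiveDefinite.

Theorem proposition14 (R : realType) (K N : nat) (hN : (0 < N)%N)
    (x : 'I_N -> 'cV[R]_K) (hx : forall i : 'I_N, x i != 0)
    (T : 'M[R]_K) (hT : sym_posdef T) (a0 : R) (ha0 : 0 <= a0) :
  (forall S : 'M[R]_K, KL_solution x T a0 S -> W_solution x T a0 S) /\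
  (forall S : 'M[R]_K, W_solution x T a0 S ->
     exists c : R, 0 < c /\ KL_solution x T a0 (c *: S)).
Proof.
have K_gt0 : (0 < K)%N.
  rewrite lt0n; apply: contraNneq (hx (Ordinal hN)) => K0.
  by apply/eqP/matrixP => i; have: (i < 0)%N by rewrite -K0.
have KR0 : K%:R != 0 :> R by rewrite pnatr_eq0 -lt0n.
have a1 : 1 + a0 != 0 by rewrite gt_eqF // ltr_pwDl.
have tr_gt0 S : sym_posdef S -> 0 < \tr (invmx S *m T).
  by case/sym_posdef_invmx=> _ posI; apply: mxtrace_mul_posdef_gt0.
split=> S [pdS eqS].
- split=> //; have t0 : \tr (invmx S *m T) != 0 by rewrite gt_eqF ?tr_gt0.
  rewrite {1}eqS; congr (_ + _); rewrite !scalerA; congr (_ *: _).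
  have := congr1 (fun M => \tr (invmx S *m M)) eqS.
  rewrite /= mulVmx ?sym_posdef_unitmx // mxtrace1 mulmxDr mxtraceD.
  rewrite mxtrace_invmx_data_term // -scalemxAr mxtraceZ => trE.
  (* The coefficient stays on both sides to cover [a0 = 0], where the trace identity does not
     determine the trace of [S^-1 T] but both [T] terms vanish. *)
  have trK : a0 / (1 + a0) * K%:R = a0 / (1 + a0) * \tr (invmx S *m T).
    apply: (addrI (K%:R / (1 + a0))); rewrite -trE; by field.
  by rewrite mulrAC trK mulfK.
- have t_gt0 := tr_gt0 S pdS.
  exists (\tr (invmx S *m T) / K%:R).
  have c_gt0 : 0 < \tr (invmx S *m T) / K%:R by rewrite divr_gt0 ?ltr0n.
  split=> //; split; first exact: sym_posdefZ.
  (* Occurrence 2 is the matrix being scaled; the first lies inside the trace in [c]. Scaling (W) by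
     [c] cancels both the trace and [K] in front of [T]. *)
  rewrite data_termZ ?gt_eqF ?sym_posdef_unitmx // {2}eqS scalerDr.
  congr (_ + _); rewrite !scalerA; congr (_ *: _).
  by field; rewrite a1 KR0 gt_eqF.
Qed.
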